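(* ${\sf VS}$ directly interprets ${\sf VS}^+$, i.e. ${\sf VS} \rhd_{\sf dir} {\sf VS}^+$, and the direct interpretation can be taken to be one-dimensional.
   Context: Theories are first-order theories of finite signature. ${\sf VS}$ (Vaught set theory) is the theory in the language $\{\in\}$ with the axioms $\exists x\,\forall y\, y\notin x$ and, for every $n$, $\forall u_0\dots\forall u_{n-1}\,\exists x\,\forall y\,(y\in x\leftrightarrow \bigvee_{i<n} y=u_i)$ (no extensionality). Kuratowski pairs are defined as usual (not necessarily unique). $f$ is a function iff for all $u,v\in f$, if $u,v$ are pairs and their first components are equal then $u=v$. $f:x\sim y$ means $f$ is a bijection between $x$ and $y$ (in this sense), and $x\sim y$ means $\exists f\, f:x\sim y$. ${\sf VS}^+$ is ${\sf VS}$ plus axioms stating that $\sim$ is an equivalence relation and that $f:x\sim y$ implies $x\sim f$. A direct interpretation is an interpretation that is unrelativized (the domain is everything) and identity preserving (identity translated as identity). *)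

(* Defs.v *)
From mathcomp Require Import all_boot.
From Stdlib Require List.

Set Implicit Arguments.
Unset Strict Implicit.
Unset Printing Implicit Defensive.

(** * First-order logic with identity over finite relational signatures *)

Record signature := Signature { symbol :> finType; arity : symbol -> nat }.

(* Variables are de Bruijn indices; since signatures are relational they are
   the only terms, so substitutions are renamings. *)
Inductive form (S : signature) : Type :=
| fBot
| fEq (x y : nat)
| fAtom (R : symbol S) (xs : (arity R).-tuple nat)
| fImp (p q : form S)
| fAll (p : form S).

Arguments fBot {S}.
Arguments fEq {S} x y.

Section Connectives.
Variable S : signature.
Implicit Types p q : form S.

Definition fNot p := fImp p fBot.
Definition fTop : form S := fNot fBot.
Definition fAnd p q := fNot (fImp p (fNot q)).
Definition fOr p q := fImp (fNot p) q.
Definition fIff p q := fAnd (fImp p q) (fImp q p).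
Definition fEx p := fNot (fAll (fNot p)).

(* Without a trailing [fTop], so that a one-element conjunction is its
   conjunct. *)
Fixpoint bigAnd (ps : seq (form S)) : form S :=
  match ps with
  | [::] => fTop
  | [:: p] => p
  | p :: ps' => fAnd p (bigAnd ps')
  end.

Definition bigOr (ps : seq (form S)) : form S := foldr fOr fBot ps.

Definition up (r : nat -> nat) (i : nat) : nat :=
  if i is j.+1 then (r j).+1 else 0.

Fixpoint rename (r : nat -> nat) (p : form S) : form S :=
  match p with
  | fBot => fBot
  | fEq x y => fEq (r x) (r y)
  | fAtom R xs => fAtom [tuple of map r xs]
  | fImp p q => fImp (rename r p) (rename r q)
  | fAll p => fAll (rename (up r) p)
  end.

Definition shift : form S -> form S := rename succn.

(* [inst t p] is [p] with the outermost variable 0 replaced by [t]. *)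
Definition inst (t : nat) : form S -> form S :=
  rename (fun i => if i is j.+1 then j else t).

(* All free variables of [p] are [< n]. *)
Fixpoint bounded (n : nat) (p : form S) : bool :=
  match p with
  | fBot => true
  | fEq x y => (x < n) && (y < n)
  | fAtom R xs => all (fun x => x < n) xs
  | fImp p q => bounded n p && bounded n q
  | fAll p => bounded n.+1 p
  end.

Definition sentence (p : form S) : Prop := bounded 0 p.

Record theory := Theory {
  axiom : form S -> Prop;
  axiom_sentence : forall p, axiom p -> sentence p }.

(* Classical natural deduction; [derives T G p] allows the axioms of [T] in
   addition to the finite list of assumptions [G]. *)
Inductive derives (T : theory) : seq (form S) -> form S -> Prop :=
| d_axiom G p : axiom T p -> derives T G p
| d_hyp G p : List.In p G -> derives T G p
| d_impI G p q : derives T (p :: G) q -> derives T G (fImp p q)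
| d_impE G p q : derives T G (fImp p q) -> derives T G p -> derives T G q
| d_dne G p : derives T G (fNot (fNot p)) -> derives T G p
| d_allI G p : derives T (map shift G) p -> derives T G (fAll p)
| d_allE G p t : derives T G (fAll p) -> derives T G (inst t p)
| d_refl G x : derives T G (fEq x x)
| d_leibniz G p x y :
    derives T G (fEq x y) -> derives T G (inst x p) -> derives T G (inst y p).

Definition proves (T : theory) (p : form S) : Prop := derives T [::] p.

End Connectives.

(** * Interpretations *)

(* A variable [x] of the interpreted language becomes the block of variables
   [x * m, ..., x * m + m.-1], where [m] is the dimension.  The formulas of a
   translation have as parameters the first one, two, or [arity R] blocks;
   [blocks m xs] puts the blocks of the variables [xs] in their place. *)
Definition blocks (m : nat) (xs : seq nat) (k : nat) : nat :=
  nth 0 xs (k %/ m) * m + k %% m.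

(* Parameter-free, many-dimensional, relativized translations of the language
   of [S] into that of [S']. *)
Record translation (S S' : signature) := Translation {
  dim : nat;
  dom : form S';
  eqf : form S';
  relf : symbol S -> form S';
  dim_gt0 : 0 < dim;
  dom_bounded : bounded dim dom;
  eqf_bounded : bounded (2 * dim) eqf;
  relf_bounded : forall R, bounded (arity R * dim) (relf R) }.

Section Interpretations.
Variables S S' : signature.
Implicit Types (tau : translation S S') (U : theory S') (V : theory S).

Fixpoint translate tau (p : form S) : form S' :=
  match p with
  | fBot => fBot
  | fEq x y => rename (blocks (dim tau) [:: x; y]) (eqf tau)
  | fAtom R xs => rename (blocks (dim tau) xs) (relf tau R)
  | fImp p q => fImp (translate tau p) (translate tau q)
  | fAll p =>
      iter (dim tau) (@fAll S') (fImp (dom tau) (translate tau p))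
  end.

Definition is_interpretation U tau V : Prop :=
  forall p : form S, sentence p -> proves V p -> proves U (translate tau p).

Definition unrelativized tau : Prop := dom tau = fTop S'.

Definition identity_preserving tau : Prop :=
  eqf tau = bigAnd [seq fEq j (dim tau + j) | j <- iota 0 (dim tau)].

Definition direct tau : Prop := unrelativized tau /\ identity_preserving tau.

Definition directly_interprets U V : Prop :=
  exists tau, is_interpretation U tau V /\ direct tau.

End Interpretations.

(** * The theories VS and VS+ *)

Definition Lmem : signature := Signature (fun _ : unit => 2).

Definition mem_ (x y : nat) : form Lmem :=
  @fAtom Lmem tt [tuple x; y].

Definition all_in (x : nat) (p : form Lmem) : form Lmem :=
  fAll (fImp (mem_ 0 x.+1) p).

Definition ex_in (x : nat) (p : form Lmem) : form Lmem :=
  fEx (fAnd (mem_ 0 x.+1) p).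

Definition empty_set_axiom : form Lmem := fEx (fAll (fNot (mem_ 0 1))).

(* In the matrix, 0 is y, 1 is x, and 2, ..., n.+1 are the u_i. *)
Definition finite_set_axiom (n : nat) : form Lmem :=
  iter n (@fAll Lmem)
    (fEx (fAll (fIff (mem_ 0 1)
                     (bigOr [seq fEq 0 i.+2 | i <- iota 0 n])))).

Inductive VS_axiom : form Lmem -> Prop :=
| VS_empty : VS_axiom empty_set_axiom
| VS_finite n : VS_axiom (finite_set_axiom n).

(* In the next definitions the arguments are variables of the ambient context,
   hence the successors under binders. *)

(* s = {a} *)
Definition is_singleton (s a : nat) : form Lmem :=
  fAll (fIff (mem_ 0 s.+1) (fEq 0 a.+1)).

(* s = {a, b} *)
Definition is_upair (s a b : nat) : form Lmem :=
  fAll (fIff (mem_ 0 s.+1) (fOr (fEq 0 a.+1) (fEq 0 b.+1))).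

(* u = {s, t} for some s = {a} and t = {a, b}; without extensionality u, s and
   t need not be unique, and other copies of s and t need not be in u. *)
Definition is_pair (u a b : nat) : form Lmem :=
  fEx (fEx (fAnd (is_singleton 1 a.+2)
           (fAnd (is_upair 0 a.+2 b.+2)
                 (is_upair u.+2 1 0)))).

(* For u, v in f and all a, b, c: if u is a pair of a, b and v is a pair of
   a, c, then u = v as elements of the domain. *)
Definition is_function (f : nat) : form Lmem :=
  all_in f (all_in f.+1
    (fAll (fAll (fAll
      (fImp (is_pair 4 2 1) (fImp (is_pair 3 2 0) (fEq 4 3))))))).

(* Every element of f is a pair with components in x and y. *)
Definition is_relation (f x y : nat) : form Lmem :=
  all_in f (ex_in x.+1 (ex_in y.+2 (is_pair 2 1 0))).

(* Every a in x is the first component of a pair in f. *)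
Definition is_total (f x : nat) : form Lmem :=
  all_in x (ex_in f.+1 (fEx (is_pair 1 2 0))).

(* Every b in y is the second component of a pair in f. *)
Definition is_onto (f y : nat) : form Lmem :=
  all_in y (ex_in f.+1 (fEx (is_pair 1 0 2))).

(* For u, v in f and all a, b, c: if u is a pair of a, c and v is a pair of
   b, c, then a = b. *)
Definition is_injective (f : nat) : form Lmem :=
  all_in f (all_in f.+1
    (fAll (fAll (fAll
      (fImp (is_pair 4 2 0) (fImp (is_pair 3 1 0) (fEq 2 1))))))).

(* f : x ~ y.  That f consists of pairs is part of the definition:
   [is_function] alone would allow arbitrary other elements. *)
Definition is_bijection (f x y : nat) : form Lmem :=
  fAnd (is_function f)
 (fAnd (is_relation f x y)
 (fAnd (is_total f x)
 (fAnd (is_onto f y)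
       (is_injective f)))).

(* x ~ y *)
Definition equinumerous (x y : nat) : form Lmem :=
  fEx (is_bijection 0 x.+1 y.+1).

Inductive VSplus_axiom : form Lmem -> Prop :=
| VSplus_VS p : VS_axiom p -> VSplus_axiom p
| VSplus_refl : VSplus_axiom (fAll (equinumerous 0 0))
| VSplus_sym :
    VSplus_axiom (fAll (fAll (fImp (equinumerous 1 0) (equinumerous 0 1))))
| VSplus_trans :
    VSplus_axiom (fAll (fAll (fAll
      (fImp (equinumerous 2 1)
        (fImp (equinumerous 1 0) (equinumerous 2 0))))))
| VSplus_graph :
    VSplus_axiom (fAll (fAll (fAll
      (fImp (is_bijection 2 1 0) (equinumerous 1 2))))).

Lemma bounded_iter_all (S : signature) n k (p : form S) :
  bounded k (iter n (@fAll S) p) = bounded (n + k) p.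
Proof. by elim: n k => //= n IHn k; rewrite IHn addnS. Qed.

Lemma bounded_bigOr (S : signature) k (ps : seq (form S)) :
  bounded k (bigOr ps) = all (bounded k) ps.
Proof. by elim: ps => //= p ps ->; rewrite andbT. Qed.

Lemma VS_axiom_sentence p : VS_axiom p -> sentence p.
Proof.
case=> // n; rewrite /sentence bounded_iter_all addn0.
have bn : bounded n.+2 (bigOr [seq @fEq Lmem 0 i.+2 | i <- iota 0 n]).
  rewrite bounded_bigOr.
  rewrite all_map; apply/allP=> i; rewrite mem_iota add0n /= => lt_in.
  by rewrite !ltnS.
by rewrite [bounded _ _]/= bn.
Qed.

Lemma VSplus_axiom_sentence p : VSplus_axiom p -> sentence p.
Proof. by case=> // q /VS_axiom_sentence. Qed.

Definition VS : theory Lmem := Theory VS_axiom_sentence.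
Definition VSplus : theory Lmem := Theory VSplus_axiom_sentence.

(* Main.v *)
Require Import Defs.
From mathcomp Require Import all_boot.
From Stdlib Require List.
From Stdlib Require Import Classical ClassicalEpsilon.
From Stdlib Require Import FunctionalExtensionality PropExtensionality.
From Stdlib Require Import Setoid.

(** Membership is reinterpreted as [y] in [x] and [x] good, so that sets that
    are not good become empty.  Call a set function with domain [x] a family
    over [x].  The set [x] is good if the families over [x] contain the
    identity, are closed under pairing and under composition with set functions
    [g] (both [i |-> g (f i)] and [i |-> the element of g that is a pair with
    first component f i]), and have sets as ranges.  Sets with a standard finite
    number of elements are good, so the axioms of VS survive and pairs do not
    change.  Goodness only quantifies over families, hence it is inherited by
    the range [y] of an injective family [a] over [x]: families over [y] are
    pulled back along [a], and a family [h] over [x] is pushed forward as the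
    range of the family of pairs of [a i] and [h i].  A family [f] over a good
    [x] is itself the range of the injective family [i |-> the element of f with
    first component i], so [f] is good and equinumerous with [x].

    By the completeness theorem it suffices to carry out this argument in an
    arbitrary model of VS. *)

Set Implicit Arguments.
Unset Strict Implicit.
Unset Printing Implicit Defensive.

(** * Renaming of variables in formulas and derivations *)

Section Renaming.
Variable S : signature.
Implicit Types (p q : form S) (G : seq (form S)) (T : theory S).

Lemma rename_eq_bounded n p r s :
  bounded n p -> (forall i, i < n -> r i = s i) -> rename r p = rename s p.
Proof.
elim: p n r s => [|x y|R xs|p IHp q IHq|p IHp] n r s //=.
- by case/andP=> ltx lty ers; rewrite !ers.
- move/allP=> ltxs ers; congr fAtom; apply: val_inj => /=.
  by apply/eq_in_map => x /ltxs /ers.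
- by case/andP=> bp bq ers; rewrite (IHp _ _ _ bp ers) (IHq _ _ _ bq ers).
- move=> bp ers; congr fAll; apply: IHp bp _ => -[|i] //=.
  by rewrite ltnS => /ers ->.
Qed.

Lemma rename_ext p r s : r =1 s -> rename r p = rename s p.
Proof.
elim: p r s => [|x y|R xs|p IHp q IHq|p IHp] r s ers //=.
- by rewrite !ers.
- by congr fAtom; apply: val_inj; apply: eq_map.
- by rewrite (IHp _ _ ers) (IHq _ _ ers).
- by congr fAll; apply: IHp => -[|i] //=; rewrite ers.
Qed.

Lemma rename_comp p r s : rename r (rename s p) = rename (r \o s) p.
Proof.
elim: p r s => [|x y|R xs|p IHp q IHq|p IHp] r s //=.
- by congr fAtom; apply: val_inj; rewrite /= -map_comp.
- by rewrite IHp IHq.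
- by rewrite IHp; congr fAll; apply: rename_ext => -[|i].
Qed.

Lemma rename_id p : rename id p = p.
Proof.
elim: p => [|x y|R xs|p IHp q IHq|p IHp] //=.
- by congr fAtom; apply: val_inj; rewrite /= map_id.
- by rewrite IHp IHq.
- by rewrite -[in RHS]IHp; congr fAll; apply: rename_ext => -[|i].
Qed.

Lemma rename_sentence r p : sentence p -> rename r p = p.
Proof. by move=> sp; rewrite -[RHS]rename_id; apply: rename_eq_bounded sp _. Qed.

Lemma rename_inst r t p : rename r (inst t p) = inst (r t) (rename (up r) p).
Proof. by rewrite /inst !rename_comp; apply: rename_ext => -[|i]. Qed.

Lemma rename_shift r p : rename (up r) (shift p) = shift (rename r p).
Proof. by rewrite /shift !rename_comp; apply: rename_ext. Qed.

Fixpoint bound p : nat :=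
  match p with
  | fBot => 0
  | fEq x y => maxn x.+1 y.+1
  | fAtom R xs => \max_(x <- xs) x.+1
  | fImp p q => maxn (bound p) (bound q)
  | fAll p => (bound p).-1
  end.

Lemma bound_bounded n p : bound p <= n -> bounded n p.
Proof.
elim: p n => [|x y|R xs|p IHp q IHq|p IHp] n //=.
- by rewrite geq_max.
- by move=> /bigmax_leqP_seq le_n; apply/allP => x xs_x; apply: le_n.
- by rewrite geq_max => /andP[/IHp -> /IHq ->].
- by move=> le_n; apply: IHp; apply: leq_trans (leqSpred _) _.
Qed.

Lemma derives_weaken T G G' p :
  derives T G p -> (forall q, List.In q G -> List.In q G') -> derives T G' p.
Proof.
move=> d; elim: d G' => {G p}
  [G p ax|G p Gp|G p q _ IH|G p q _ IH1 _ IH2|G p _ IH|G p _ IH|G p t _ IH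
  |G x|G p x y _ IH1 _ IH2] G' sGG'.
- exact: d_axiom.
- exact: d_hyp (sGG' _ Gp).
- by apply/d_impI/IH => r /= [->|/sGG']; [left|right].
- exact: d_impE (IH1 _ sGG') (IH2 _ sGG').
- exact: d_dne (IH _ sGG').
- apply/d_allI/IH => r /(List.in_map_iff (@shift S)) [s [<- /sGG' Gs]].
  exact: List.in_map.
- exact: d_allE (IH _ sGG').
- exact: d_refl.
- exact: d_leibniz (IH1 _ sGG') (IH2 _ sGG').
Qed.

(** Axioms are sentences, so renaming fixes them; under a quantifier [up r] commutes with [shift],
    which keeps the context shifted. *)
Lemma derives_rename T G p r :
  derives T G p -> derives T (map (rename r) G) (rename r p).
Proof.
move=> d; elim: d r => {G p}
  [G p ax|G p Gp|G p q _ IH|G p q _ IH1 _ IH2|G p _ IH|G p _ IH|G p t _ IH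
  |G x|G p x y _ IH1 _ IH2] r /=.
- by rewrite rename_sentence; [apply: d_axiom|apply: axiom_sentence ax].
- exact/d_hyp/List.in_map.
- exact/d_impI/IH.
- exact: d_impE (IH1 r) (IH2 r).
- exact/d_dne/IH.
- apply: d_allI; rewrite -map_comp -(eq_map (rename_shift r)) map_comp.
  exact: IH.
- by rewrite rename_inst; apply/d_allE/IH.
- exact: d_refl.
- rewrite rename_inst; apply: d_leibniz (IH1 r) _.
  by rewrite -rename_inst.
Qed.

End Renaming.

(** * Soundness and completeness *)

Record model (S : signature) := Model {
  carrier :> Type;
  interp : forall R : symbol S, (arity R).-tuple carrier -> Prop }.

Definition scons (D : Type) (d : D) (rho : nat -> D) (i : nat) : D :=
  if i is j.+1 then rho j else d.

Fixpoint sat (S : signature) (M : model S) (rho : nat -> M) (p : form S)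
    : Prop :=
  match p with
  | fBot => False
  | fEq x y => rho x = rho y
  | fAtom R xs => interp [tuple of map rho xs]
  | fImp p q => sat rho p -> sat rho q
  | fAll p => forall d, sat (scons d rho) p
  end.

Definition satisfies (S : signature) (M : model S) (T : theory S) : Prop :=
  forall (rho : nat -> M) p, axiom T p -> sat rho p.

Section Semantics.
Variables (S : signature) (M : model S).
Implicit Types (p q : form S) (G : seq (form S)) (T : theory S).
Implicit Types (rho : nat -> M) (P Q : Prop).

Lemma sat_ext p rho rho' : rho =1 rho' -> sat rho p <-> sat rho' p.
Proof. by move/functional_extensionality->. Qed.

Lemma sat_rename p r rho : sat rho (rename r p) <-> sat (rho \o r) p.
Proof.
elim: p r rho => [|x y|R xs|p IHp q IHq|p IHp] r rho //=.
- suff ->: [tuple of map rho [tuple of map r xs]] = [tuple of map (rho \o r) xs].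
    by [].
  by apply: val_inj; rewrite /= -map_comp.
- by rewrite IHp IHq.
- have e d : scons d rho \o up r =1 scons d (rho \o r) by case.
  by split=> h d; move: (h d); rewrite IHp (sat_ext _ (e d)).
Qed.

Lemma sat_inst p t rho : sat rho (inst t p) <-> sat (scons (rho t) rho) p.
Proof. by rewrite sat_rename; apply: sat_ext => -[|i]. Qed.

Theorem soundness T G p rho :
  satisfies M T -> derives T G p ->
  (forall q, List.In q G -> sat rho q) -> sat rho p.
Proof.
move=> MT d; elim: d rho => {G p}
  [G p ax|G p Gp|G p q _ IH|G p q _ IH1 _ IH2|G p _ IH|G p _ IH|G p t _ IH
  |G x|G p x y _ IH1 _ IH2] rho hG /=.
- exact: MT.
- exact: hG.
- by move=> hp; apply: IH => r [<-|/hG].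
- exact: IH1 (IH2 _ hG).
- exact: NNPP (IH rho hG).
- move=> d; apply: IH => r /(List.in_map_iff (@shift S)) [s [<- /hG hs]].
  by rewrite /shift sat_rename.
- by apply/sat_inst/IH.
- by [].
- by apply/sat_inst; rewrite -(IH1 _ hG); apply/sat_inst/IH2.
Qed.

(** The readings [P] and [Q] are arbitrary, so that the meaning of a compound formula can be
    assembled by unification, one connective at a time. *)
Lemma sat_fImp p q P Q rho :
  (sat rho p <-> P) -> (sat rho q <-> Q) -> sat rho (fImp p q) <-> (P -> Q).
Proof. by move=> /= -> ->. Qed.

Lemma sat_fAnd p q P Q rho :
  (sat rho p <-> P) -> (sat rho q <-> Q) -> sat rho (fAnd p q) <-> P /\ Q.
Proof. by move=> /= -> ->; split; [move=> h; apply: NNPP; tauto | tauto]. Qed.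

Lemma sat_fOr p q P Q rho :
  (sat rho p <-> P) -> (sat rho q <-> Q) -> sat rho (fOr p q) <-> P \/ Q.
Proof. by move=> /= -> ->; split; [move=> h; apply: NNPP; tauto | tauto]. Qed.

Lemma sat_fIff p q P Q rho :
  (sat rho p <-> P) -> (sat rho q <-> Q) -> sat rho (fIff p q) <-> (P <-> Q).
Proof. by move=> hp hq; apply: sat_fAnd; apply: sat_fImp. Qed.

Lemma sat_fAll p (P : M -> Prop) rho :
  (forall d, sat (scons d rho) p <-> P d) ->
  sat rho (fAll p) <-> (forall d, P d).
Proof. by move=> hp; split=> /= h d; apply/hp. Qed.

Lemma sat_fEx p (P : M -> Prop) rho :
  (forall d, sat (scons d rho) p <-> P d) ->
  sat rho (fEx p) <-> (exists d, P d).
Proof.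
move=> hp; split=> /= [h|[d /hp hd] h]; last exact: h hd.
by apply: NNPP => n; apply: h => d /hp hd; apply: n; exists d.
Qed.

Lemma sat_bigOr rho (I : Type) (F : I -> form S) (s : seq I) :
  sat rho (bigOr (map F s)) <-> exists2 i, List.In i s & sat rho (F i).
Proof.
elim: s => [|i s IHs] /=; first by split=> // -[].
split=> [/(sat_fOr (iff_refl _) IHs)[hi|[j sj hj]]|[j [<-|sj] hj]].
- by exists i; [left|].
- by exists j; [right|].
- by apply/(sat_fOr (iff_refl _) IHs); left.
- by apply/(sat_fOr (iff_refl _) IHs); right; exists j.
Qed.

Lemma sat_iter_fAll rho n p :
  sat rho (iter n (@fAll S) p) <->
  (forall ds, size ds = n -> sat (foldl (fun r d => scons d r) rho ds) p).
Proof.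
elim: n rho => [|n IHn] rho /=.
  by split=> [h [] //|/(_ [::] erefl)].
split=> [h [//|d ds] [/esym en] /=|h d].
  by apply: (proj1 (IHn _) (h d)).
by apply/IHn => ds en; apply: (h (d :: ds)); rewrite /= en.
Qed.

End Semantics.

(** * Countability of the set of formulas *)

Section Coding.
Variable S : signature.

(** Generic trees over [nat] are countable; the node label records the constructor. *)
Fixpoint tree_of_form (p : form S) : GenTree.tree nat :=
  match p with
  | fBot => GenTree.Node 0 [::]
  | fEq x y => GenTree.Node 1 [:: GenTree.Leaf x; GenTree.Leaf y]
  | fAtom R xs =>
      GenTree.Node 2 (GenTree.Leaf (pickle R) :: map (@GenTree.Leaf nat) xs)
  | fImp p q => GenTree.Node 3 [:: tree_of_form p; tree_of_form q]
  | fAll p => GenTree.Node 4 [:: tree_of_form p]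
  end.

Lemma tree_of_form_inj : injective tree_of_form.
Proof.
elim=> [|x y|R xs|p IHp q IHq|p IHp] [|x' y'|R' xs'|p' q'|p'] //=.
- by case=> -> ->.
- case=> /(pcan_inj pickleK) eR; subst R'.
  by move/inj_map=> exs; congr fAtom; apply/val_inj/exs => ? ? [].
- by case=> /IHp -> /IHq ->.
- by case=> /IHp ->.
Qed.

(* Opaque, so that unification does not evaluate codes of concrete formulas. *)
Lemma form_countable : {code : form S -> nat | injective code}.
Proof.
exists (fun p => pickle (tree_of_form p)).
by move=> p q /(pcan_inj pickleK) /tree_of_form_inj.
Qed.

Definition code : form S -> nat := sval form_countable.

Lemma code_inj : injective code.
Proof. exact: svalP form_countable. Qed.

Definition decode (n : nat) : form S :=
  epsilon (inhabits fBot) (fun p => code p = n).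

Lemma codeK : cancel code decode.
Proof.
move=> p; apply: code_inj.
by apply: (epsilon_spec _ (fun q => code q = code p)); exists p.
Qed.

End Coding.

(** * Henkin's construction of a term model *)

Section Completeness.
Variables (S : signature) (T : theory S).
Implicit Types (p q : form S) (G : seq (form S)).

Definition consistent G := ~ derives T G fBot.

Lemma derives_hd p G : derives T (p :: G) p.
Proof. by apply: d_hyp; left. Qed.

Lemma derives_contra p G : derives T (fNot p :: G) fBot -> derives T G p.
Proof. by move=> d; apply/d_dne/d_impI. Qed.

(** The renaming sends the fresh variable [c] to 0 and shifts the variables below it: on [G] it is
    [shift], and on [inst c p] it undoes the instantiation. *)
Lemma derives_generalize c p G :
  (forall q, List.In q G -> bounded c q) -> bounded c.+1 p ->
  derives T G (inst c p) -> derives T G (fAll p).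
Proof.
move=> bG bp /(derives_rename (fun i => if i == c then 0 else i.+1)) d.
apply: d_allI.
suff [<- <-] : map (rename (fun i => if i == c then 0 else i.+1)) G
               = map (@shift S) G
            /\ rename (fun i => if i == c then 0 else i.+1) (inst c p) = p.
  exact: d.
split.
  apply: List.map_ext_in => q /bG bq.
  by apply: rename_eq_bounded bq _ => i; rewrite ltn_neqAle => /andP[/negPf-> _].
rewrite /inst rename_comp -[RHS]rename_id; apply: rename_eq_bounded bp _.
by case=> [|i] /=; rewrite ?eqxx // ltnS ltn_neqAle => /andP[/negPf-> _].
Qed.

Definition fresh p G : nat := \max_(q <- p :: G) bound q.

Lemma fresh_bounded p G q : List.In q (p :: G) -> bounded (fresh p G) q.
Proof.
move=> Gq; apply: bound_bounded; rewrite /fresh.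
elim: (p :: G) Gq => //= r s IHs; rewrite big_cons => -[->|/IHs le_q].
  exact: leq_maxl.
by rewrite leq_max le_q orbT.
Qed.

(** Variables serve as Henkin constants: contexts are finite lists, so a fresh variable always
    exists and the signature stays the same. *)
Definition witness p G : seq (form S) :=
  if p is fImp (fAll q) fBot then fNot (inst (fresh p G) q) :: p :: G
  else p :: G.

Lemma witness_sub p G q : List.In q (p :: G) -> List.In q (witness p G).
Proof. by case: p => //= -[] // p [] //=; right. Qed.

(** If the witness made the context inconsistent, the instance at a fresh variable would be
    derivable, hence by generalization the universal formula that [p] negates. *)
Lemma witness_consistent p G : consistent (p :: G) -> consistent (witness p G).
Proof.
case: p => // -[] // q [] // con /derives_contra d; apply: con.
apply: d_impE (derives_hd _ _) _; apply: (derives_generalize _ _ d).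
  exact: fresh_bounded.
have : bounded (fresh (fNot (fAll q)) G) (fNot (fAll q)).
  by apply: fresh_bounded; left.
by rewrite /= andbT.
Qed.

Definition extend p G : seq (form S) :=
  if excluded_middle_informative (consistent (p :: G)) then witness p G else G.

Lemma extend_in p G : consistent (p :: G) -> extend p G = witness p G.
Proof. by rewrite /extend; case: excluded_middle_informative. Qed.

Lemma extend_out p G : ~ consistent (p :: G) -> extend p G = G.
Proof. by rewrite /extend; case: excluded_middle_informative. Qed.

Lemma extend_sub p G q : List.In q G -> List.In q (extend p G).
Proof.
have [con|inc] := classic (consistent (p :: G)).
  by rewrite extend_in // => Gq; apply: witness_sub; right.
by rewrite extend_out.
Qed.

Lemma extend_consistent p G : consistent G -> consistent (extend p G).
Proof.
have [con|inc] := classic (consistent (p :: G)); last by rewrite extend_out.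
by rewrite extend_in // => _; apply: witness_consistent.
Qed.

Variable G0 : seq (form S).
Hypothesis G0_con : consistent G0.

(** As [decode] is a left inverse of [code], every formula [p] is considered, namely on passing from
    stage [code p] to the next one. *)
Fixpoint stage n : seq (form S) :=
  if n is m.+1 then extend (decode S m) (stage m) else G0.

Definition henkin p : Prop := exists n, List.In p (stage n).

Lemma stage_code p : stage (code p).+1 = extend p (stage (code p)).
Proof. by rewrite /= codeK. Qed.

Lemma stage_mono m n p : m <= n -> List.In p (stage m) -> List.In p (stage n).
Proof.
by move/subnKC <-; elim: (n - m) => [|k IHk] sp;
   rewrite ?addn0 // addnS; apply/extend_sub/IHk.
Qed.

Lemma stage_consistent n : consistent (stage n).
Proof. by elim: n => // n IHn; apply: extend_consistent. Qed.

Lemma henkin_stage G :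
  (forall p, List.In p G -> henkin p) ->
  exists n, forall p, List.In p G -> List.In p (stage n).
Proof.
elim: G => [|p G IHG] hG; first by exists 0.
have [n hn] := IHG (fun q Gq => hG q (or_intror Gq)).
have [m hm] := hG p (or_introl erefl).
exists (maxn m n) => q [<-|/hn].
  exact: stage_mono (leq_maxl m n) hm.
exact: stage_mono (leq_maxr m n).
Qed.

Lemma henkin_consistent G : (forall p, List.In p G -> henkin p) -> consistent G.
Proof.
by move=> /henkin_stage[n hn] /derives_weaken /(_ hn); apply: stage_consistent.
Qed.

Lemma decide_stage p : henkin p \/ exists n, derives T (stage n) (fNot p).
Proof.
have [con|inc] := classic (consistent (p :: stage (code p))).
  left; exists (code p).+1; rewrite stage_code extend_in //.
  by apply: witness_sub; left.
right; exists (code p); apply: d_impI; exact: NNPP inc.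
Qed.

Lemma henkin_derives G p :
  (forall q, List.In q G -> henkin q) -> derives T G p -> henkin p.
Proof.
move=> /henkin_stage[n hn] d; have [//|[m dN]] := decide_stage p.
case: (@stage_consistent (maxn n m)).
apply: d_impE (derives_weaken dN _) (derives_weaken d _) => q.
  by apply: stage_mono; apply: leq_maxr.
by move/hn; apply: stage_mono; apply: leq_maxl.
Qed.

Lemma henkin_not p : henkin (fNot p) <-> ~ henkin p.
Proof.
split=> [hN h|nh].
  apply: (@henkin_consistent [:: fNot p; p]) => [q [<-|[<-|[]]] //|].
  by apply: d_impE (derives_hd _ _) _; apply: d_hyp; right; left.
have [//|[n d]] := decide_stage p.
by apply: henkin_derives d => q sq; exists n.
Qed.

Lemma henkin_imp p q : henkin (fImp p q) <-> (henkin p -> henkin q).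
Proof.
split=> [hpq hp|h].
  apply: (@henkin_derives [:: fImp p q; p]) => [r [<-|[<-|[]]] //|].
  by apply: d_impE (derives_hd _ _) _; apply: d_hyp; right; left.
have [/h hq|/henkin_not nhp] := classic (henkin p).
  apply: (@henkin_derives [:: q]) => [r [<-|[]] //|].
  by apply: d_impI; apply: d_hyp; right; left.
apply: (@henkin_derives [:: fNot p]) => [r [<-|[]] //|].
apply: d_impI; apply/derives_contra.
by apply: (@d_impE _ _ _ p); apply: d_hyp; [right; right; left|right; left].
Qed.

Lemma henkin_all p : henkin (fAll p) <-> (forall c, henkin (inst c p)).
Proof.
split=> [h c|h].
  apply: (@henkin_derives [:: fAll p]) => [r [<-|[]] //|].
  exact/d_allE/derives_hd.
(* A negated universal formula in the Henkin set is consistent with the stage at which it is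
   considered, so its witness was added there. *)
apply: NNPP => /henkin_not hN; set q := fNot (fAll p) in hN.
have con : consistent (q :: stage (code q)).
  apply: henkin_consistent => r [<-|sr]; first exact: hN.
  exact: ex_intro _ (code q) sr.
suff /henkin_not : henkin (fNot (inst (fresh q (stage (code q))) p)).
  by apply; apply: h.
by exists (code q).+1; rewrite stage_code (extend_in con); left.
Qed.

Lemma henkin_refl x : henkin (fEq x x).
Proof. by apply: (@henkin_derives [::]) => //; apply: d_refl. Qed.

Lemma henkin_leibniz x y p :
  henkin (fEq x y) -> henkin (inst x p) -> henkin (inst y p).
Proof.
move=> exy hx; apply: (@henkin_derives [:: fEq x y; inst x p]).
  by move=> r [<-|[<-|[]]].
by apply: (@d_leibniz _ _ _ _ x); apply: d_hyp; [left|right; left].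
Qed.

Lemma henkin_sym x y : henkin (fEq x y) -> henkin (fEq y x).
Proof.
move=> exy.
(* The instances of [fEq 0 x.+1] at [x] and [y] are [fEq x x] and [fEq y x]. *)
exact: (@henkin_leibniz x y (fEq 0 x.+1) exy (henkin_refl x)).
Qed.

Lemma henkin_trans x y z :
  henkin (fEq x y) -> henkin (fEq y z) -> henkin (fEq x z).
Proof. by move=> exy eyz; apply: (@henkin_leibniz y z (fEq x.+1 0) eyz). Qed.

(** Leibniz's rule replaces one variable at a time: [rs n] has switched from [r] to [s] below [n],
    and at [bound p] all free variables are switched. *)
Lemma henkin_congr r s p :
  (forall i, henkin (fEq (r i) (s i))) ->
  henkin (rename r p) -> henkin (rename s p).
Proof.
move=> ers hr.
pose rs n i := if i < n then s i else r i.
suff h n : henkin (rename (rs n) p).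
  rewrite (_ : rename s p = rename (rs (bound p)) p) //.
  apply: rename_eq_bounded (bound_bounded (leqnn _)) _ => i ltip.
  by rewrite /rs ltip.
elim: n => [|n IHn]; first by rewrite (rename_ext _ (s := r)).
(* Variable [n] becomes the slot 0 of [q], whose instances at [r n] and [s n] are the renamings of
   [p] by [rs n] and [rs n.+1]. *)
pose q := rename (fun i => if i == n then 0 else (rs n i).+1) p.
rewrite (_ : rename (rs n.+1) p = inst (s n) q).
  apply: henkin_leibniz (ers n) _; rewrite /inst rename_comp.
  rewrite (rename_ext _ (s := rs n)) // => i /=.
  by have [->|] //= := eqVneq i n; rewrite /rs ltnn.
rewrite /inst rename_comp; apply: rename_ext => i /=.
by rewrite /rs ltnS leq_eqVlt; have [->|] := eqVneq i n.
Qed.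

(** The quotient by equality in the Henkin set is formed by chosen representatives. The choice
    depends only on the predicate, so by extensionality equal variables get the same
    representative. *)
Definition repr (x : nat) : nat :=
  epsilon (inhabits 0) (fun y => henkin (fEq x y)).

Lemma repr_eq x : henkin (fEq x (repr x)).
Proof.
apply: (epsilon_spec (inhabits 0) (fun y => henkin (fEq x y))).
by exists x; apply: henkin_refl.
Qed.

Lemma reprP x y : repr x = repr y <-> henkin (fEq x y).
Proof.
split=> [e|exy].
  by apply: henkin_trans (repr_eq x) _; rewrite e; apply/henkin_sym/repr_eq.
rewrite /repr (_ : (fun z => henkin (fEq x z)) = fun z => henkin (fEq y z)).
  by [].
apply: functional_extensionality => z; apply: propositional_extensionality.
by split; apply: henkin_trans => //; apply: henkin_sym.
Qed.

Definition term_class := {x : nat | repr x == x}.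

Lemma repr_idem x : repr (repr x) == repr x.
Proof. by apply/eqP/reprP/henkin_sym/repr_eq. Qed.

Lemma sval_inj : injective (fun c : term_class => sval c).
Proof. exact: val_inj. Qed.

Definition class_of (x : nat) : term_class := exist _ (repr x) (repr_idem x).

Lemma class_ofK (c : term_class) : class_of (sval c) = c.
Proof. by apply: sval_inj; exact/eqP/(svalP c). Qed.

Definition term_model : model S :=
  @Model S term_class
    (fun R xs => henkin (fAtom [tuple of map (fun c => sval c) xs])).

(** The renaming is arbitrary so that the quantifier case can pass to [scons c r]: every element of
    the model is the class of a variable [c]. *)
Lemma truth_lemma p r :
  sat (M := term_model) (class_of \o r) p <-> henkin (rename r p).
Proof.
elim: p r => [|x y|R xs|p IHp q IHq|p IHp] r.
- split=> //= h; apply: (@henkin_consistent [:: fBot]) => [q [<-|[]] //|].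
  exact: derives_hd.
- by rewrite /= -reprP; split=> [/(congr1 sval)|e] //; apply: sval_inj.
(* Atoms are read at representatives, which [henkin_congr] exchanges for the original variables. *)
- have -> : sat (M := term_model) (class_of \o r) (fAtom xs)
            = henkin (rename (repr \o r) (fAtom xs)).
    congr (henkin (fAtom _)); apply: val_inj.
    by rewrite /= -map_comp; apply: eq_map.
  split; apply: henkin_congr => i; last exact: repr_eq.
  exact/henkin_sym/repr_eq.
- by rewrite [rename _ _]/= henkin_imp -IHp -IHq.
- have e c : inst c (rename (up r) p) = rename (scons c r) p.
    by rewrite /inst rename_comp; apply: rename_ext => -[|i].
  have e' c : class_of \o scons c r =1 scons (class_of c) (class_of \o r).
    by case.
  rewrite [rename _ _]/= henkin_all; split=> h c.
    rewrite e -IHp (sat_ext (M := term_model) _ (e' c)); exact: h.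
  rewrite -(class_ofK c).
  by apply/(sat_ext (M := term_model) p (e' (sval c)))/IHp; rewrite -e.
Qed.

End Completeness.

Theorem completeness (S : signature) (T : theory S) (p : form S) :
  (forall (M : model S) (rho : nat -> M), satisfies M T -> sat rho p) ->
  proves T p.
Proof.
move=> valid; apply: NNPP => np.
have con : consistent T [:: fNot p] by move=> /derives_contra.
have classE (rho : nat -> term_model T [:: fNot p]) :
    rho = class_of con \o (sval \o rho).
  by apply: functional_extensionality => i; rewrite /= class_ofK.
(* Axioms are sentences, so the assignment is irrelevant and derivability puts them in the Henkin
   set. *)
have MT : satisfies (term_model T [:: fNot p]) T.
  move=> rho q ax; rewrite (classE rho) truth_lemma.
  rewrite rename_sentence; last exact: axiom_sentence ax.
  by apply: (henkin_derives con (G := [::])) => //; apply: d_axiom.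
have := valid (term_model T [:: fNot p]) (class_of con \o id) MT.
rewrite truth_lemma rename_id; apply/(henkin_not con).
by exists 0; left.
Qed.

(** * Families and good sets *)

Section Predicates.
Variables (D : Type) (mem : D -> D -> Prop).
Implicit Types a b c s t u v f g h x y : D.

(** Membership is a parameter because these predicates are read both in the membership of a model
    and in [good_mem]. *)
Definition Singleton s a := forall z, mem z s <-> z = a.
Definition Upair s a b := forall z, mem z s <-> z = a \/ z = b.
Definition Pair u a b :=
  exists s t, Singleton s a /\ Upair t a b /\ Upair u s t.

Definition Function f :=
  forall u, mem u f -> forall v, mem v f ->
  forall a b c, Pair u a b -> Pair v a c -> u = v.
Definition Relation f x y :=
  forall u, mem u f ->
  exists a, mem a x /\ exists b, mem b y /\ Pair u a b.
Definition Total f x :=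
  forall a, mem a x -> exists u, mem u f /\ exists b, Pair u a b.
Definition Onto f y :=
  forall b, mem b y -> exists u, mem u f /\ exists a, Pair u a b.
Definition Injective f :=
  forall u, mem u f -> forall v, mem v f ->
  forall a b c, Pair u a c -> Pair v b c -> a = b.
Definition Bijection f x y :=
  Function f /\ Relation f x y /\ Total f x /\ Onto f y /\ Injective f.

Definition App f a b := exists u, mem u f /\ Pair u a b.

Definition Family f x :=
  Function f /\
  (forall u, mem u f -> exists a, mem a x /\ exists b, Pair u a b) /\
  (forall a, mem a x -> exists b, App f a b).

Definition Composable f g :=
  Function g /\ (forall a b, App f a b -> exists c, App g b c).

Definition IdFamily x := exists f, Family f x /\ forall a, mem a x -> App f a a.

(** Pairs need not be unique, so [h] only has to take some pair of the two values as its value. *)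
Definition PairFamily x :=
  forall f g, Family f x -> Family g x ->
  exists h, Family h x /\
    forall a b c, App f a b -> App g a c -> exists u, Pair u b c /\ App h a u.

Definition FamilyRange x :=
  forall f, Family f x -> exists y, forall b, mem b y <-> exists a, App f a b.

Definition CompFamily x :=
  forall f g, Family f x -> Composable f g ->
  exists h, Family h x /\ forall a b c, App f a b -> App g b c -> App h a c.

Definition GraphFamily x :=
  forall f g, Family f x -> Composable f g ->
  exists h, Family h x /\
    forall a b c u, App f a b -> mem u g -> Pair u b c -> App h a u.

Definition Good x :=
  IdFamily x /\ PairFamily x /\ FamilyRange x /\ CompFamily x /\ GraphFamily x.

Definition good_mem y x := mem y x /\ Good x.

End Predicates.

(** * First-order definability of goodness *)

Section Reflection.
Variable M : model Lmem.
Implicit Types (rho : nat -> M) (p : form Lmem) (P : M -> Prop).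

Definition mem_of (D : model Lmem) (a b : D) : Prop :=
  @interp Lmem D tt [tuple a; b].

Local Notation mem := (@mem_of M).

Lemma sat_mem rho x y : sat rho (mem_ x y) <-> mem (rho x) (rho y).
Proof.
rewrite /= /mem_of.
by have -> : [tuple of map rho [tuple x; y]] = [tuple rho x; rho y]
  by apply: val_inj.
Qed.

Lemma sat_fEq rho x y : sat rho (fEq x y) <-> rho x = rho y.
Proof. by []. Qed.

Lemma sat_all_in rho x p P :
  (forall d, sat (scons d rho) p <-> P d) ->
  sat rho (all_in x p) <-> (forall d, mem d (rho x) -> P d).
Proof.
by move=> hp; apply: sat_fAll => d; apply: sat_fImp; [apply: sat_mem|].
Qed.

Lemma sat_ex_in rho x p P :
  (forall d, sat (scons d rho) p <-> P d) ->
  sat rho (ex_in x p) <-> (exists d, mem d (rho x) /\ P d).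
Proof.
by move=> hp; apply: sat_fEx => d; apply: sat_fAnd; [apply: sat_mem|].
Qed.

(** The order matters: the defined connectives and bounded quantifiers unfold to [fImp] and [fAll],
    so the rules for these two come last. *)
Ltac reflect_with lem :=
  repeat first
    [ lem
    | apply: sat_mem
    | apply: sat_fEq
    | apply: sat_all_in => ?
    | apply: sat_ex_in => ?
    | apply: sat_fIff
    | apply: sat_fAnd
    | apply: sat_fOr
    | apply: sat_fEx => ?
    | apply: sat_fAll => ?
    | apply: sat_fImp ].

Lemma sat_singleton rho s a :
  sat rho (is_singleton s a) <-> Singleton mem (rho s) (rho a).
Proof. reflect_with ltac:(fail). Qed.

Lemma sat_upair rho s a b :
  sat rho (is_upair s a b) <-> Upair mem (rho s) (rho a) (rho b).
Proof. reflect_with ltac:(fail). Qed.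

Lemma sat_pair rho u a b :
  sat rho (is_pair u a b) <-> Pair mem (rho u) (rho a) (rho b).
Proof.
reflect_with ltac:(first [apply: sat_singleton | apply: sat_upair]).
Qed.

Lemma sat_function rho f : sat rho (is_function f) <-> Function mem (rho f).
Proof. reflect_with ltac:(apply: sat_pair). Qed.

Lemma sat_bijection rho f x y :
  sat rho (is_bijection f x y) <-> Bijection mem (rho f) (rho x) (rho y).
Proof.
apply: sat_fAnd; first exact: sat_function.
apply: sat_fAnd; first by reflect_with ltac:(apply: sat_pair).
apply: sat_fAnd; first by reflect_with ltac:(apply: sat_pair).
apply: sat_fAnd; first by reflect_with ltac:(apply: sat_pair).
by reflect_with ltac:(apply: sat_pair).
Qed.

Lemma sat_equinumerous rho x y :
  sat rho (equinumerous x y) <-> exists f, Bijection mem f (rho x) (rho y).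
Proof. by apply: sat_fEx => f; apply: sat_bijection. Qed.

Definition is_app (f a b : nat) : form Lmem :=
  ex_in f (is_pair 0 a.+1 b.+1).

Lemma sat_app rho f a b :
  sat rho (is_app f a b) <-> App mem (rho f) (rho a) (rho b).
Proof. reflect_with ltac:(apply: sat_pair). Qed.

Definition is_family (f x : nat) : form Lmem :=
  fAnd (is_function f)
 (fAnd (all_in f (ex_in x.+1 (fEx (is_pair 2 1 0))))
       (all_in x (fEx (is_app f.+2 1 0)))).

Lemma sat_family rho f x :
  sat rho (is_family f x) <-> Family mem (rho f) (rho x).
Proof.
reflect_with ltac:(first [apply: sat_function | apply: sat_app | apply: sat_pair]).
Qed.

Definition is_composable (f g : nat) : form Lmem :=
  fAnd (is_function g)
       (fAll (fAll (fImp (is_app f.+2 1 0) (fEx (is_app g.+3 1 0))))).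

Lemma sat_composable rho f g :
  sat rho (is_composable f g) <-> Composable mem (rho f) (rho g).
Proof. reflect_with ltac:(first [apply: sat_function | apply: sat_app]). Qed.

Definition id_family (x : nat) : form Lmem :=
  fEx (fAnd (is_family 0 x.+1) (all_in x.+1 (is_app 1 0 0))).

Definition pair_family (x : nat) : form Lmem :=
  fAll (fAll (fImp (is_family 1 x.+2) (fImp (is_family 0 x.+2)
    (fEx (fAnd (is_family 0 x.+3)
      (fAll (fAll (fAll (fImp (is_app 5 2 1) (fImp (is_app 4 2 0)
        (fEx (fAnd (is_pair 0 2 1) (is_app 4 3 0))))))))))))).

Definition family_range (x : nat) : form Lmem :=
  fAll (fImp (is_family 0 x.+1)
    (fEx (fAll (fIff (mem_ 0 1) (fEx (is_app 3 0 1)))))).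

Definition comp_family (x : nat) : form Lmem :=
  fAll (fAll (fImp (is_family 1 x.+2) (fImp (is_composable 1 0)
    (fEx (fAnd (is_family 0 x.+3)
      (fAll (fAll (fAll (fImp (is_app 5 2 1) (fImp (is_app 4 1 0)
        (is_app 3 2 0))))))))))).

Definition graph_family (x : nat) : form Lmem :=
  fAll (fAll (fImp (is_family 1 x.+2) (fImp (is_composable 1 0)
    (fEx (fAnd (is_family 0 x.+3)
      (fAll (fAll (fAll (fAll (fImp (is_app 6 3 2) (fImp (mem_ 0 5)
        (fImp (is_pair 0 2 1) (is_app 4 3 0))))))))))))).

Definition is_good (x : nat) : form Lmem :=
  fAnd (id_family x) (fAnd (pair_family x) (fAnd (family_range x)
 (fAnd (comp_family x) (graph_family x)))).

Lemma sat_good rho x : sat rho (is_good x) <-> Good mem (rho x).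
Proof.
reflect_with ltac:(first [apply: sat_family | apply: sat_composable
                         | apply: sat_app | apply: sat_pair]).
Qed.

(** The value pushed last becomes variable 0, so the environment lists [us] backwards; this is the
    reason for the reversals in [sat_finite_set]. *)
Lemma foldl_scons rho (us : seq M) :
  [seq foldl (fun r d => scons d r) rho us i | i <- iota 0 (size us)] = rev us.
Proof.
elim/last_ind: us => //= us d IHus.
rewrite foldl_rcons size_rcons rev_rcons /= -IHus; congr cons.
by rewrite -[1]addn0 iotaDl -map_comp.
Qed.

Lemma sat_finite_set rho n :
  sat rho (finite_set_axiom n) <->
  (forall us, size us = n -> exists x, forall y, mem y x <-> List.In y us).
Proof.
rewrite /finite_set_axiom sat_iter_fAll.
set b := fEx _.
have hb us : size us = n -> sat (foldl (fun r d => scons d r) rho us) b <->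
    exists x, forall y, mem y x <-> List.In y (rev us).
  move=> en; apply: sat_fEx => x; apply: sat_fAll => y; apply: sat_fIff.
    exact: sat_mem.
  rewrite sat_bigOr -(foldl_scons rho) List.in_map_iff en.
  by split=> -[i]; [exists i | case=> ? ?; exists i].
split=> h us en.
  by have := h (rev us); rewrite size_rev hb ?size_rev // revK; apply.
by apply/hb => //; apply: h; rewrite size_rev.
Qed.

End Reflection.

(** * Closure properties of good sets *)

Section Families.
Variables (D : Type) (mem : D -> D -> Prop).
Implicit Types a b c i j s t u v f g h x y : D.

Local Notation Pair := (Pair mem).
Local Notation Function := (Function mem).
Local Notation App := (App mem).
Local Notation Family := (Family mem).
Local Notation Composable := (Composable mem).
Local Notation Good := (Good mem).
Local Notation Bijection := (Bijection mem).

Lemma pair_inj u a b a' b' : Pair u a b -> Pair u a' b' -> a = a' /\ b = b'.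
Proof.
move=> [s [t [hs [ht hu]]]] [s' [t' [hs' [ht' hu']]]].
have us : mem s u by apply/hu; left.
have ut : mem t u by apply/hu; right.
have ut' : mem t' u by apply/hu'; right.
have tb : mem b t by apply/ht; right.
have tb' : mem b' t' by apply/ht'; right.
have ea : a' = a.
  by apply/hs; move/hu': us => [->|->]; [apply/hs'|apply/ht'; left].
subst a'; split=> //; move/hu': ut => [e|e].
  move: tb; rewrite e => /hs' ->; move/hu: ut' tb' => [->|->].
    by move/hs.
  by rewrite e => /hs'.
subst t'; move/ht: tb' => [e|//]; move/ht': tb => [e'|//].
by rewrite e e'.
Qed.

Lemma app_functional f a b c : Function f -> App f a b -> App f a c -> b = c.
Proof.
move=> ff [u [fu ua]] [v [fv va]].
by have := ff u fu v fv a b c ua va => e; subst v; case: (pair_inj ua va).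
Qed.

Lemma family_dom f x a b : Family f x -> App f a b -> mem a x.
Proof.
by move=> [_ [h _]] [u [/h[a' [xa' [b' ua']]] ua]]; case: (pair_inj ua ua') => ->.
Qed.

Definition OneOne f := forall i j b, App f i b -> App f j b -> i = j.

Definition Range f y := forall b, mem b y <-> exists a, App f a b.

(** Pairs determine their components, so conditions on the elements of [f] become conditions on its
    values; the closure arguments below work in this form. *)
Lemma bijectionP f x y :
  Bijection f x y <-> Family f x /\ OneOne f /\ Range f y.
Proof.
split=> [[ff [rf [tf [onf injf]]]]|[ffx [injf rf]]].
  have ffx : Family f x.
    split=> //; split=> [u /rf [a [xa [b [_ uab]]]]|a /tf [u [fu [b uab]]]].
      by exists a; split=> //; exists b.
    by exists b, u.
  split=> //; split=> [i j b [u [fu ui]] [v [fv vj]]|b].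
    exact: injf u fu v fv i j b ui vj.
  split=> [/onf [u [fu [a uab]]]|[a [u [fu uab]]]]; first by exists a, u.
  by have [a' [_ [b' [yb' uab']]]] := rf u fu; case: (pair_inj uab uab') => _ ->.
have [ff [df tf]] := ffx.
split=> //; split=> [u fu|].
  have [a [xa [b uab]]] := df u fu; exists a; split=> //; exists b; split=> //.
  by apply/rf; exists a, u.
split=> [a /tf [b [u [fu uab]]]|]; first by exists u; split=> //; exists b.
split=> [b /rf [a [u [fu uab]]]|]; first by exists u; split=> //; exists a.
by move=> u fu v fv a b c ua vb; apply: (injf a b c); [exists u|exists v].
Qed.

Section Transfer.
Variables (x y f : D).
Hypotheses (x_good : Good x) (f_fam : Family f x) (f_inj : OneOne f).
Hypothesis f_range : Range f y.

(** The set [k] is the range of the family [p] of pairs of [f i] and [h i]. As [f] is one-one, two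
    elements of [k] with the same first component come from the same index, and so are the same
    value of [p]. *)
Lemma family_push h : Family h x ->
  exists k, Family k y /\ forall i b c, App f i b -> App h i c -> App k b c.
Proof.
case: x_good => _ [hpair [hrange _]] hx.
have [p [px hp]] := hpair f h f_fam hx.
have [k hk] := hrange p px.
have [pf [_ pt]] := px; have [hf [_ ht]] := hx; have [ff [_ ft]] := f_fam.
have elt u : mem u k -> exists i b c,
    [/\ App f i b, App h i c, Pair u b c & App p i u].
  move=> /hk [i piu]; have xi := family_dom px piu.
  have [b fib] := ft i xi; have [c hic] := ht i xi.
  have [u' [u'bc piu']] := hp i b c fib hic.
  by rewrite (app_functional pf piu piu'); exists i, b, c; split.
have app i b c : App f i b -> App h i c -> App k b c.
  move=> fib hic; have [u [ubc piu]] := hp i b c fib hic.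
  by exists u; split=> //; apply/hk; exists i.
exists k; split=> //; split; last split.
- move=> u /elt [i [b [c [fib _ ubc piu]]]] v /elt [j [b' [c' [fjb _ vbc pjv]]]].
  move=> a d d' ua va; have [eb _] := pair_inj ubc ua.
  have [eb' _] := pair_inj vbc va.
  subst b b'; have e := f_inj fib fjb; subst j.
  exact: app_functional pf piu pjv.
- move=> u /elt [i [b [c [fib _ ubc _]]]]; exists b; split; last by exists c.
  by apply/f_range; exists i.
- move=> b /f_range [i fib]; have [c hic] := ht i (family_dom f_fam fib).
  by exists c; apply: app fib hic.
Qed.

Lemma family_pull g : Family g y ->
  exists h, Family h x /\ forall i b c, App f i b -> App g b c -> App h i c.
Proof.
case: x_good => _ [_ [_ [hcomp _]]] [gf [gd gt]].
apply: hcomp => //; split=> // a b fab.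
by apply: gt; apply/f_range; exists a.
Qed.

Lemma pull_app g h i b c :
  Family g y -> Family h x ->
  (forall i b c, App f i b -> App g b c -> App h i c) ->
  App f i b -> App h i c -> App g b c.
Proof.
move=> [_ [_ gt]] [hf _] hfg fib hic.
have [d gbd] : exists d, App g b d by apply: gt; apply/f_range; exists i.
by rewrite (app_functional hf hic (hfg i b d fib gbd)).
Qed.

Lemma composable_pull g h e :
  Family g y -> Family h x ->
  (forall i b c, App f i b -> App g b c -> App h i c) ->
  Composable g e -> Composable h e.
Proof.
move=> gy hx hfg [ef eg]; split=> // i c hic; have [_ [_ ft]] := f_fam.
have [b fib] := ft i (family_dom hx hic); apply: (eg b c).
exact: pull_app gy hx hfg fib hic.
Qed.

Lemma app_range b g c : Family g y -> App g b c -> exists i, App f i b.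
Proof. by move=> gy gbc; apply/f_range; apply: family_dom gy gbc. Qed.

(** Families over [y] are pulled back to [x], the closure property is used there, and the result is
    pushed forward. Ranges need no pushing, as pulling back preserves them. *)
Lemma good_range : Good y.
Proof.
have [hid [hpair [hrange [hcomp hgraph]]]] := x_good.
split; last split; last split; last split.
(* Pushed forward along itself, [f] becomes the identity on [y]. *)
- have [k [ky hk]] := family_push f_fam; exists k; split=> // b /f_range [i fib].
  exact: (hk _ _ _ fib fib).
- move=> g g' gy gy'.
  have [h [hx hfg]] := family_pull gy; have [h' [hx' hfg']] := family_pull gy'.
  have [p [px hp]] := hpair h h' hx hx'; have [k [ky hk]] := family_push px.
  exists k; split=> // b c d gbc gbd; have [i fib] := app_range gy gbc.
  have [u [ucd piu]] := hp i c d (hfg _ _ _ fib gbc) (hfg' _ _ _ fib gbd).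
  by exists u; split=> //; apply: hk fib piu.
- move=> g gy; have [h [hx hfg]] := family_pull gy.
  have [z hz] := hrange h hx; exists z => c; rewrite hz; split=> [[i hic]|[b gbc]].
    have [_ [_ ft]] := f_fam; have [b fib] := ft i (family_dom hx hic).
    by exists b; apply: pull_app gy hx hfg fib hic.
  by have [i fib] := app_range gy gbc; exists i; apply: hfg fib gbc.
- move=> g e gy ge; have [h [hx hfg]] := family_pull gy.
  have [p [px hp]] := hcomp h e hx (composable_pull gy hx hfg ge).
  have [k [ky hk]] := family_push px; exists k; split=> // b c d gbc ecd.
  have [i fib] := app_range gy gbc; apply: (hk _ _ _ fib).
  exact: hp (hfg _ _ _ fib gbc) ecd.
- move=> g e gy ge; have [h [hx hfg]] := family_pull gy.
  have [p [px hp]] := hgraph h e hx (composable_pull gy hx hfg ge).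
  have [k [ky hk]] := family_push px; exists k; split=> // b c d u gbc eu ucd.
  have [i fib] := app_range gy gbc; apply: (hk _ _ _ fib).
  exact: hp (hfg _ _ _ fib gbc) eu ucd.
Qed.

End Transfer.

Lemma good_bijection f x y : Good x -> Bijection f x y -> Good y.
Proof. by move=> xg /bijectionP [fx [fi fr]]; apply: good_range xg fx fi fr. Qed.

(** [GraphFamily], applied to the identity and [f], sends each [a] in [x] to the element of [f] with
    first component [a]. This is one-one because pairs determine their first components. *)
Lemma family_bijection f x :
  Good x -> Family f x -> exists h, Bijection h x f.
Proof.
move=> [[e [ex he]] [_ [_ [_ hgraph]]]] fx.
have [ff [fd ft]] := fx.
have [] := hgraph e f ex.
  split=> // a b eab; apply: ft; have xa := family_dom ex eab.
  by case: ex => ef _; rewrite (app_functional ef eab (he a xa)).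
move=> h [hx hh]; exists h; apply/bijectionP; split=> //.
have elt u : mem u f -> exists a b, [/\ mem a x, Pair u a b & App h a u].
  move=> fu; have [a [xa [b uab]]] := fd u fu; exists a, b; split=> //.
  exact: hh (he a xa) fu uab.
have app a u : App h a u -> mem u f /\ exists b, Pair u a b.
  move=> hau; have xa := family_dom hx hau; have [b [v [fv vab]]] := ft a xa.
  case: hx => hf _; rewrite (app_functional hf hau (hh _ _ _ _ (he a xa) fv vab)).
  by split=> //; exists b.
split=> [i j u /app [_ [b uib]] /app [_ [b' ujb]]|u].
  by case: (pair_inj uib ujb).
by split=> [/elt [a [b [_ _ hau]]]|[a /app []]] //; exists a.
Qed.

Lemma good_family f x : Good x -> Family f x -> Good f.
Proof. by move=> xg /(family_bijection xg) [h]; apply: good_bijection. Qed.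

Lemma good_refl x : Good x -> exists f, Good f /\ Bijection f x x.
Proof.
move=> xg; have [[e [ex he]] _] := xg; exists e; split.
  exact: good_family xg ex.
have app a b : App e a b -> a = b.
  move=> eab; have xa := family_dom ex eab.
  by case: ex => ef _; apply/esym/(app_functional ef eab)/he.
apply/bijectionP; split=> //; split=> [i j b /app -> /app -> //|b].
split=> [xb|[a eab]]; first by exists b; apply: he.
by rewrite -(app _ _ eab); apply: family_dom ex eab.
Qed.

Lemma good_sym f x y :
  Good x -> Bijection f x y -> exists g, Good g /\ Bijection g y x.
Proof.
move=> xg bf; have yg := good_bijection xg bf.
have [fx [fi fr]] := proj1 (bijectionP _ _ _) bf.
have [[e [ex he]] _] := xg.
(* The identity on [x], pushed forward along [f], is the inverse of [f]. *)
have [g [gy hg]] := family_push xg fx fi fr ex.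
have inv i b : App f i b -> App g b i.
  by move=> fib; apply: hg fib (he i (family_dom fx fib)).
have inv' i b : App g b i -> App f i b.
  move=> gbi; have /fr [j fjb] := family_dom gy gbi; case: gy => gf _.
  by rewrite (app_functional gf gbi (inv j b fjb)).
exists g; split; first exact: good_family yg gy.
apply/bijectionP; split=> //; split=> [b b' i /inv' fib /inv' fib'|i].
  by case: fx => ff _; apply: app_functional ff fib fib'.
split=> [xi|[b /inv']]; last exact: family_dom.
by case: fx => _ [_ /(_ i xi) [b /inv gbi]]; exists b.
Qed.

Lemma good_trans f g x y z :
  Good x -> Bijection f x y -> Bijection g y z ->
  exists h, Good h /\ Bijection h x z.
Proof.
move=> xg /bijectionP [fx [fi fr]] /bijectionP [gy [gi gr]].
have [_ [_ [_ [hcomp _]]]] := xg.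
have [ff [_ ft]] := fx; have [gf [_ gt]] := gy.
have [] := hcomp f g fx.
  by split=> // a b fab; apply: gt; apply/fr; exists a.
move=> h [hx hh]; exists h; split; first exact: good_family xg hx.
have app a c : App h a c -> exists b, App f a b /\ App g b c.
  move=> hac; have [b fab] := ft a (family_dom hx hac).
  have [d gbd] : exists d, App g b d by apply: gt; apply/fr; exists a.
  exists b; split=> //; case: hx => hf _.
  by rewrite (app_functional hf hac (hh _ _ _ fab gbd)).
apply/bijectionP; split=> //; split=> [i j c|c].
  move=> /app [b [fib gbc]] /app [b' [fjb' gbc']].
  by have e := gi _ _ _ gbc gbc'; subst b'; apply: fi fib fjb'.
split=> [/gr [b gbc]|[a /app [b [_ gbc]]]]; last by apply/gr; exists b.
by have /fr [a fab] := family_dom gy gbc; exists a; apply: hh fab gbc.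
Qed.

Lemma good_graph f x y :
  Good x -> Bijection f x y -> exists h, Good h /\ Bijection h x f.
Proof.
move=> xg /bijectionP [fx _]; have [h bh] := family_bijection xg fx.
exists h; split=> //; have /bijectionP [hx _] := bh.
exact: good_family xg hx.
Qed.

Hypothesis finite_sets :
  forall us : seq D, exists x, forall y, mem y x <-> List.In y us.

Lemma pair_exists a b : exists u, Pair u a b.
Proof.
have [s hs] := finite_sets [:: a]; have [t ht] := finite_sets [:: a; b].
have [u hu] := finite_sets [:: s; t]; exists u, s, t.
by split; [|split] => z; rewrite ?hs ?ht ?hu /=; intuition.
Qed.

Section Finite.
Variables (x : D) (us : seq D).
Hypothesis x_us : forall y, mem y x <-> List.In y us.

(** Values and pairs are chosen in the metatheory. Taking a single pair for each argument makes [f]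
    a function although pairs are not unique. *)
Lemma finite_family (R : D -> D -> Prop) :
  (forall a, mem a x -> exists b, R a b) ->
  exists f, Family f x /\ forall a, mem a x -> exists b, R a b /\ App f a b.
Proof.
move=> hR; pose F a := epsilon (inhabits a) (R a).
have hF a : mem a x -> R a (F a) by move/hR; apply: epsilon_spec.
pose p a := epsilon (inhabits a) (fun u => Pair u a (F a)).
have hp a : Pair (p a) a (F a).
  exact: (epsilon_spec _ (fun u => Pair u a (F a))) (pair_exists a (F a)).
have [f hf] := finite_sets (map p us).
have elt u : mem u f <-> exists a, p a = u /\ mem a x.
  rewrite hf List.in_map_iff.
  by split=> -[a [pa ua]]; exists a; split=> //; apply/x_us.
have app a : mem a x -> App f a (F a).
  by move=> xa; exists (p a); split=> //; apply/elt; exists a.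
exists f; split; last by move=> a xa; exists (F a); split; [apply: hF|apply: app].
split; last split.
- move=> u /elt [a [<- _]] v /elt [b [<- _]] c d d' pc pc'.
  have [ea _] := pair_inj (hp a) pc; have [eb _] := pair_inj (hp b) pc'.
  by rewrite ea eb.
- by move=> u /elt [a [<- xa]]; exists a; split=> //; exists (F a).
- by move=> a /app; exists (F a).
Qed.

(** By [finite_family] it is enough that the desired value exists at each argument; for ranges, the
    finite list of values is collected directly. *)
Lemma finite_good : Good x.
Proof.
split; last split; last split; last split.
- have [a _|f [fx hf]] := @finite_family (fun a b => a = b); first by exists a.
  by exists f; split=> // a /hf [b [<-]].
- move=> f g fx gx; have [ff [_ ft]] := fx; have [gf [_ gt]] := gx.
  have [|h [hx hh]] :=
    @finite_family (fun a u => exists b c, [/\ App f a b, App g a c & Pair u b c]).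
    move=> a xa; have [b fab] := ft a xa; have [c gac] := gt a xa.
    by have [u ubc] := pair_exists b c; exists u, b, c.
  exists h; split=> // a b c fab gac.
  have [u [[b' [c' [fab' gac' ubc]]] hau]] := hh a (family_dom fx fab).
  exists u; split=> //.
  by rewrite (app_functional ff fab fab') (app_functional gf gac gac').
- move=> f fx; have [ff [_ ft]] := fx.
  pose F a := epsilon (inhabits a) (App f a).
  have hF a : mem a x -> App f a (F a) by move/ft; apply: epsilon_spec.
  have [y hy] := finite_sets (map F us); exists y => b.
  rewrite hy List.in_map_iff; split=> [[a [<- /x_us xa]]|[a fab]].
    by exists a; apply: hF.
  have xa := family_dom fx fab; exists a; split; last exact/x_us.
  exact: app_functional ff (hF a xa) fab.
- move=> f g fx [gf fg]; have [ff [_ ft]] := fx.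
  have [|h [hx hh]] := @finite_family (fun a c => exists b, App f a b /\ App g b c).
    move=> a xa; have [b fab] := ft a xa; have [c gbc] := fg a b fab.
    by exists c, b.
  exists h; split=> // a b c fab gbc.
  have [c' [[b' [fab' gbc']] hac]] := hh a (family_dom fx fab).
  have e := app_functional ff fab fab'; subst b'.
  by rewrite (app_functional gf gbc gbc').
- move=> f g fx [gf fg]; have [ff [_ ft]] := fx.
  have [|h [hx hh]] := @finite_family
      (fun a u => exists b c, [/\ App f a b, mem u g & Pair u b c]).
    move=> a xa; have [b fab] := ft a xa; have [c [u [gu ubc]]] := fg a b fab.
    by exists u, b, c.
  exists h; split=> // a b c u fab gu ubc.
  have [v [[b' [c' [fab' gv vbc]]] hav]] := hh a (family_dom fx fab).
  have e := app_functional ff fab fab'; subst b'.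
  (* A function has only one element with first component [b], so the chosen [v] is [u]. *)
  by rewrite (gf u gu v gv b c c' ubc vbc).
Qed.

End Finite.

End Families.

(** * Membership in good sets as a model of [VSplus] *)

Section GoodMembership.
Variables (D : Type) (mem : D -> D -> Prop).
Implicit Types a b s t u f x y : D.

Hypothesis finite_sets :
  forall us : seq D, exists x, forall y, mem y x <-> List.In y us.

Lemma good_mem_finite us :
  exists x, forall y, good_mem mem y x <-> List.In y us.
Proof.
have [x hx] := finite_sets us; exists x => y; rewrite /good_mem hx.
by have := finite_good finite_sets hx; tauto.
Qed.

Lemma good_mem_good x y : Good mem x -> good_mem mem y x <-> mem y x.
Proof. by rewrite /good_mem; tauto. Qed.

(** A set that is not good is empty for the new membership, and the empty set is finite, hence
    good. *)
Lemma good_copy x :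
  exists x', Good mem x' /\ forall y, good_mem mem y x <-> mem y x'.
Proof.
have [xg|nxg] := classic (Good mem x).
  by exists x; split=> // y; apply: good_mem_good.
have [e he] := finite_sets [::]; exists e.
split; first exact: (finite_good finite_sets he).
by move=> y; rewrite he; split=> // -[_ /nxg].
Qed.

(** Forwards, the sets involved have members in the new sense, so they are good. Backwards, they
    have at most two elements and are good by finiteness. *)
Lemma pair_good_mem u a b : Pair (good_mem mem) u a b <-> Pair mem u a b.
Proof.
have gS m s c : Singleton m s c -> forall y, m y s <-> List.In y [:: c].
  by move=> h y; rewrite h /=; intuition.
have gU m t c d : Upair m t c d -> forall y, m y t <-> List.In y [:: c; d].
  by move=> h y; rewrite h /=; intuition.
have gm x c : good_mem mem c x -> Good mem x by case.
split=> -[s [t [hs [ht hu]]]]; exists s, t.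
  have gs : Good mem s by apply: (gm s a); apply/hs.
  have gt : Good mem t by apply: (gm t a); apply/ht; left.
  have gu : Good mem u by apply: (gm u s); apply/hu; left.
  split; last split; move=> z.
  - by rewrite -hs good_mem_good.
  - by rewrite -ht good_mem_good.
  - by rewrite -hu good_mem_good.
have gs := finite_good finite_sets (gS _ _ _ hs).
have gt := finite_good finite_sets (gU _ _ _ _ ht).
have gu := finite_good finite_sets (gU _ _ _ _ hu).
by split; [|split]; move=> z; rewrite good_mem_good.
Qed.

(** Bijections depend on their arguments only through elements and pairs, and pairs do not
    change. *)
Lemma bijection_good_mem f x y f' x' y' :
  (forall z, good_mem mem z f <-> mem z f') ->
  (forall z, good_mem mem z x <-> mem z x') ->
  (forall z, good_mem mem z y <-> mem z y') ->
  Bijection (good_mem mem) f x y <-> Bijection mem f' x' y'.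
Proof.
move=> ef ex ey.
rewrite /Bijection /Function /Relation /Total /Onto /Injective.
setoid_rewrite ef; setoid_rewrite ex; setoid_rewrite ey.
by setoid_rewrite pair_good_mem.
Qed.

End GoodMembership.

Definition good_model (M : model Lmem) : model Lmem :=
  @Model Lmem M (fun R (t : 2.-tuple M) =>
    good_mem (@mem_of M) (tnth t ord0) (tnth t ord_max)).

Lemma satisfies_finite_sets (M : model Lmem) (rho : nat -> M) :
  satisfies M VS ->
  forall us : seq M, exists x, forall y, mem_of y x <-> List.In y us.
Proof.
move=> MVS us.
have /sat_finite_set := MVS rho _ (VS_finite (size us)).
by apply.
Qed.

(** Hypotheses on [~] are moved to good copies in the old membership, where the closure lemmas
    apply. The bijection produced is good, so it keeps its elements in the new membership. *)
Lemma good_model_VSplus (M : model Lmem) :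
  satisfies M VS -> satisfies (good_model M) VSplus.
Proof.
move=> MVS rho p ax.
have fs := satisfies_finite_sets (rho : nat -> M) MVS.
have fs' := good_mem_finite fs.
have copy := good_copy fs.
have bijE := bijection_good_mem fs.
case: ax => {p} [p [|n]| | | |].
- have [x hx] := fs' [::].
  apply/(@sat_fEx _ (good_model M) _ (fun x => forall y, ~ mem_of y x)).
    by move=> d; apply: sat_fAll => z; apply: sat_fImp; [apply: sat_mem|].
  by exists x => y /hx.
- by apply/sat_finite_set => us _; apply: fs'.
- move=> x; apply/sat_equinumerous; have [x' [xg ex]] := copy x.
  have [f [fg bf]] := good_refl xg; exists f.
  by apply/(bijE f x x f x' x') => // z; apply: good_mem_good.
- move=> x y; apply/(sat_fImp (sat_equinumerous _ _ _) (sat_equinumerous _ _ _)).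
  move=> [f bf]; have [x' [xg ex]] := copy x; have [y' [yg ey]] := copy y.
  have [f' [_ ef]] := copy f.
  move/(bijE f x y f' x' y' ef ex ey): bf => /(good_sym xg)[g [gg bg]].
  by exists g; apply/(bijE g y x g y' x') => // z; apply: good_mem_good.
- move=> x y z.
  apply/(sat_fImp (sat_equinumerous _ _ _)
    (sat_fImp (sat_equinumerous _ _ _) (sat_equinumerous _ _ _))).
  move=> [f bf] [g bg].
  have [x' [xg ex]] := copy x; have [y' [yg ey]] := copy y.
  have [z' [_ ez]] := copy z.
  have [f' [_ ef]] := copy f; have [g' [_ eg]] := copy g.
  move/(bijE f x y f' x' y' ef ex ey): bf => bf.
  move/(bijE g y z g' y' z' eg ey ez): bg => bg.
  have [h [hg bh]] := good_trans xg bf bg.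
  by exists h; apply/(bijE h x z h x' z') => // u; apply: good_mem_good.
- move=> f x y.
  apply/(sat_fImp (sat_bijection _ _ _ _) (sat_equinumerous _ _ _)) => bf.
  have [x' [xg ex]] := copy x; have [y' [_ ey]] := copy y.
  have [f' [_ ef]] := copy f.
  move/(bijE f x y f' x' y' ef ex ey): bf => /(good_graph xg)[h [hg bh]].
  by exists h; apply/(bijE h x f h x' f') => // u; apply: good_mem_good.
Qed.

(** * The one-dimensional direct translation *)

Lemma good_mem_bounded (R : symbol Lmem) :
  bounded (arity R * 1) (fAnd (mem_ 0 1) (is_good 1)).
Proof. by []. Qed.

Definition good_translation : translation Lmem Lmem :=
  @Translation Lmem Lmem 1 (fTop Lmem) (@fEq Lmem 0 1)
    (fun _ => fAnd (mem_ 0 1) (is_good 1)) isT isT isT good_mem_bounded.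

Lemma sat_good_translation (M : model Lmem) p (rho : nat -> M) :
  sat rho (translate good_translation p) <-> sat (M := good_model M) rho p.
Proof.
elim: p rho => [|x y|R xs|p IHp q IHq|p IHp] rho //.
(* In dimension 1 the block of a variable is the variable itself. *)
- by rewrite /= /blocks /= !muln1 !addn0.
- have e : sat rho (translate good_translation (fAtom xs)) <->
    mem_of (rho (nth 0 xs 0)) (rho (nth 0 xs 1)) /\
    Good (@mem_of M) (rho (nth 0 xs 1)).
    rewrite -[translate _ _]/(rename (blocks 1 xs)
      (fAnd (mem_ 0 1) (is_good 1))).
    rewrite sat_rename.
    apply: sat_fAnd; [rewrite sat_mem|rewrite sat_good];
    by rewrite /= /blocks !divn1 !modn1 !muln1 !addn0.
  rewrite e /=.
  have h (i : 'I_2) : tnth [tuple of map rho xs] i = rho (nth 0 xs i).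
    by rewrite tnth_map (tnth_nth 0).
  by rewrite !h.
- by rewrite /= IHp IHq.
- rewrite -[translate _ _]/(fAll (fImp (fTop Lmem)
    (translate good_translation p))).
  split=> [h d|h d _]; last exact/IHp/(h d).
  by apply/IHp; apply: (h d).
Qed.

Theorem theorem2p1 :
  directly_interprets VS VSplus /\
  exists tau : translation Lmem Lmem,
    [/\ is_interpretation VS tau VSplus, direct tau & dim tau = 1].
Proof.
have interp : is_interpretation VS good_translation VSplus.
  move=> p _ pr; apply: completeness => M rho MVS.
  apply/sat_good_translation.
  by apply: (soundness (good_model_VSplus MVS) pr).
(* The one-element conjunction of identities computes to [fEq 0 1], so directness holds by
   reduction. *)
have dir : direct good_translation by [].
by split; exists good_translation.
Qed.
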